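(* BigTwoDisjointSets $\le_{ql}$ MinimumClosenessCentrality.
   Context: Quasilinear reductions: for an instance $I$ let $s(I)$ be its size. A quasilinear Karp reduction from problem $\mathcal P$ to problem $\mathcal Q$ (written $\mathcal P\le_{ql}\mathcal Q$) is a function $\Phi$ from instances of $\mathcal P$ to instances of $\mathcal Q$ such that for every instance $I$ of $\mathcal P$: $\Phi(I)$ can be computed in time $\tilde O(s(I))$ (that is, $O(s(I)\log^j s(I))$ for a fixed $j$), and $I$ and $\Phi(I)$ have the same output. BigTwoDisjointSets: input is a finite set $X$ and a collection $\mathcal C$ of subsets of $X$ with $|X|<\log^{c}(|\mathcal C|)$ for a fixed constant $c$ (sets represented as lists); output True if there are two disjoint sets $C,C'\in\mathcal C$, False otherwise. MinimumClosenessCentrality: input is an undirected graph $G=(V,E)$ and a threshold $\sigma$; output True if there is a vertex $v$ whose closeness centrality $\frac{1}{\sum_{w\in V}d(v,w)}$ is smaller than $\sigma$, False otherwise, where $d(v,w)$ is the shortest-path distance. *)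

(* Defs.v *)
From HB Require Import structures.
From mathcomp Require Import all_boot all_order all_algebra.
From mathcomp Require Import boolp classical_sets reals ereal exp.
Set Implicit Arguments.
Unset Strict Implicit.
Unset Printing Implicit Defensive.
Import Order.TTheory GRing.Theory Num.Theory.

(* Random access machine of S. A. Cook and R. A. Reckhow, "Time bounded random
   access machines" (J. Comput. System Sci. 7, 1973), with its logarithmic cost
   measure.  Registers hold natural numbers, so subtraction is truncated.
   Input is a one-way read-only stream of numbers (0 is read after its end),
   output a write-only one. *)
Inductive instr :=
| Const (i a : nat)    (* X_i := a *)
| Add (i j k : nat)    (* X_i := X_j + X_k *)
| Sub (i j k : nat)    (* X_i := X_j - X_k *)
| LoadInd (i j : nat)     (* X_i := X_(X_j) *)
| StoreInd (i j : nat)    (* X_(X_i) := X_j *)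
| Jump (l j : nat)     (* go to instruction l if X_j > 0 *)
| Read (i : nat)
| Print (i : nat).

Record config := Config {
  pc : nat;
  reg : nat -> nat;
  input : seq nat;
  output : seq nat
}.

Definition set_reg (X : nat -> nat) (i v : nat) : nat -> nat :=
  fun k => if k == i then v else X k.

Definition exec (s : config) (ins : instr) : config :=
  let: Config p X u w := s in
  match ins with
  | Const i a => Config p.+1 (set_reg X i a) u w
  | Add i j k => Config p.+1 (set_reg X i (X j + X k)) u w
  | Sub i j k => Config p.+1 (set_reg X i (X j - X k)) u w
  | LoadInd i j => Config p.+1 (set_reg X i (X (X j))) u w
  | StoreInd i j => Config p.+1 (set_reg X (X i) (X j)) u w
  | Jump l j => Config (if 0 < X j then l else p.+1) X u w
  | Read i => Config p.+1 (set_reg X i (head 0 u)) (behead u) w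
  | Print i => Config p.+1 X u (rcons w (X i))
  end.

(* Number of binary digits; bitlen 0 = 1. *)
Definition bitlen (n : nat) : nat := (trunc_log 2 n).+1.

Definition cost (s : config) (ins : instr) : nat :=
  let X := reg s in
  match ins with
  | Const _ _ => 1
  | Add _ j k | Sub _ j k => bitlen (X j) + bitlen (X k)
  | LoadInd _ j => bitlen (X j) + bitlen (X (X j))
  | StoreInd i j => bitlen (X i) + bitlen (X j)
  | Jump _ j => bitlen (X j)
  | Read _ => bitlen (head 0 (input s))
  | Print i => bitlen (X i)
  end.

(* halts_in P s t w : started in s, P halts after total cost t with output w.
   The machine halts when the program counter leaves the program. *)
Inductive halts_in (P : seq instr) : config -> nat -> seq nat -> Prop :=
| halts_now s : size P <= pc s -> halts_in P s 0 (output s)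
| halts_step s ins t w :
    onth P (pc s) = Some ins -> halts_in P (exec s ins) t w ->
    halts_in P s (cost s ins + t) w.

Definition init (u : seq nat) : config := Config 0 (fun=> 0) u [::].

Record problem := Problem {
  instance :> Type;
  encode : instance -> seq nat;
  answer : instance -> Prop
}.

Definition inst_size (P : problem) (I : P) : nat :=
  \sum_(a <- encode I) bitlen a.

Definition quasilinear (f : nat -> nat) : Prop :=
  exists j C s0 : nat, forall s, s0 <= s -> f s <= C * (s * trunc_log 2 s ^ j).

Definition ql_computable (P Q : problem) (Phi : P -> Q) : Prop :=
  exists (prog : seq instr) (f : nat -> nat), quasilinear f /\
    forall I : P, exists2 t, t <= f (inst_size I) &
      halts_in prog (init (encode I)) t (encode (Phi I)).

Definition ql_reducible (P Q : problem) : Prop :=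
  exists2 Phi : P -> Q, ql_computable Phi &
    forall I : P, answer I <-> answer (Phi I).

Notation "P '<=ql' Q" := (ql_reducible P Q) (at level 70, no associativity).

Section BigTwoDisjointSets.
Local Open Scope ring_scope.
Variables (R : realType) (c : R).

Definition log2 (x : R) : R := ln x / ln 2.

(* The ground set is X = 'I_n.  A subset of X is a duplicate-free list, and the
   collection is a list of such lists no two of which have the same elements,
   so that its size is the cardinality of the collection.  As ln 0 = ln 1 = 0
   and 0 `^ c = 0 for c != 0, tds_big excludes collections of at most one set
   unless c = 0. *)
Record bigTDS_instance := BigTDSInstance {
  tds_n : nat;
  tds_sets : seq (seq 'I_tds_n);
  tds_uniq_elements : all uniq tds_sets;
  tds_uniq_sets : uniq [seq [set x in C] | C : seq 'I_tds_n <- tds_sets];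
  tds_big : tds_n%:R < log2 (size tds_sets)%:R `^ c
}.

Definition tds_collection (I : bigTDS_instance) : seq {set 'I_(tds_n I)} :=
  [seq [set x in C] | C : seq 'I_(tds_n I) <- tds_sets I].

Definition tds_encode (I : bigTDS_instance) : seq nat :=
  [:: tds_n I, size (tds_sets I)
    & flatten [seq size C :: [seq val x | x <- C] | C <- tds_sets I]].

Definition tds_answer (I : bigTDS_instance) : Prop :=
  exists C C' : {set 'I_(tds_n I)},
    [/\ C \in tds_collection I, C' \in tds_collection I,
        C <> C' & [disjoint C & C']].

Definition BigTwoDisjointSets : problem := Problem tds_encode tds_answer.

End BigTwoDisjointSets.

Section MinimumClosenessCentrality.
Local Open Scope ring_scope.

(* A finite simple graph on V = 'I_n given by its list of edges, the edge {x, y}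
   with x < y being listed once, as (x, y). *)
Record mcc_instance := MCCInstance {
  mcc_n : nat;
  mcc_edges : seq ('I_mcc_n * 'I_mcc_n);
  mcc_uniq : uniq mcc_edges;
  mcc_oriented : all (fun e : 'I_mcc_n * 'I_mcc_n => (e.1 < e.2)%N) mcc_edges;
  mcc_threshold : rat
}.

Definition adj (G : mcc_instance) : rel 'I_(mcc_n G) :=
  fun x y => ((x, y) \in mcc_edges G) || ((y, x) \in mcc_edges G).

Definition mcc_encode (G : mcc_instance) : seq nat :=
  [:: mcc_n G, size (mcc_edges G)
    & flatten [seq [:: val e.1; val e.2] | e <- mcc_edges G]] ++
  [:: nat_of_bool (mcc_threshold G < 0);
      `|numq (mcc_threshold G)|%N; `|denq (mcc_threshold G)|%N].

Variable R : realType.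

(* +oo when w is not reachable from v. *)
Definition dist (G : mcc_instance) (v w : 'I_(mcc_n G)) : \bar R :=
  ereal_inf [set (size p)%:R%:E | p in
    [set p : seq 'I_(mcc_n G) | path (adj (G:=G)) v p /\ last v p = w]]%classic.

(* In \bar R, 0^-1 = +oo and +oo^-1 = 0: the centrality is 0 in a disconnected
   graph and +oo in the one-vertex graph. *)
Definition closeness (G : mcc_instance) (v : 'I_(mcc_n G)) : \bar R :=
  (1 / \sum_(w < mcc_n G) dist v w)%E.

Definition mcc_answer (G : mcc_instance) : Prop :=
  exists v : 'I_(mcc_n G), (closeness v < (ratr (mcc_threshold G))%:E)%E.

Definition MinimumClosenessCentrality : problem := Problem mcc_encode mcc_answer.

End MinimumClosenessCentrality.

(* Main.v *)
Require Import Defs.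
From HB Require Import structures.
From mathcomp Require Import all_boot all_order all_algebra.
From mathcomp Require Import zify.
From mathcomp Require Import boolp reals ereal exp.

Set Implicit Arguments.
Unset Strict Implicit.
Unset Printing Implicit Defensive.
Import Order.TTheory GRing.Theory Num.Theory.

(* A family of m subsets C_i of {0, ..., n-1} is sent to a graph made of a
   clique on 3n + 2 core vertices x, x', x'' (x < n), z, z' and of two vertices
   L_i, R_i per set, adjacent to core vertices only: L_i to z and, for every x,
   to x if x is in C_i and to x' otherwise; R_i to z' and, for every x, to x if
   x is in C_i and to x'' otherwise.  All distances are at most 3, so the farness
   of v is 2(|V| - 1) - deg v + #{w : d(v, w) = 3}.  Each L_i and R_i has degree
   n + 1, and the only pairs at distance 3 are the {L_i, R_j} with C_i and C_j
   disjoint; core vertices have larger degree and nobody at distance 3.  Hence a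
   farness above 5n + 4m + 1 reveals a disjoint pair.  The pair may be (i, i)
   with C_i empty; this is harmless when m >= 2, and for m <= 1 the bound is
   raised by 2 - m.  As n is polylogarithmic in m, there are quasilinearly many
   edges, and a one-pass program marking the elements of the current set in an
   array prints them. *)

Local Open Scope nat_scope.

(** * The edge list of the graph *)

Fixpoint row_edges (b a : nat) : seq (nat * nat) :=
  if a is a'.+1 then (a', b) :: row_edges b a' else [::].

(** Descending order suits the program, whose loops count a register down to 0 because [Jump] only
    tests positivity. *)
Fixpoint clique_edges (b : nat) : seq (nat * nat) :=
  if b is b'.+1 then row_edges b' b' ++ clique_edges b' else [::].

(** The core vertices x, x', x'' have the numbers x, n + x, 2n + x: adding the offset once or twice
    gives the neighbour of L_i or of R_i. Then come z = 3n, z' = 3n + 1 and L_0, R_0, L_1, R_1, and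
    so on. *)
Definition offset (n : nat) (C : seq nat) (y : nat) : nat :=
  if y \in C then 0 else n.

(** [b] is false for L_i and true for R_i. *)
Definition nbrs (n : nat) (b : bool) (C : seq nat) : seq nat :=
  3 * n + b :: [seq y + b.+1 * offset n C y | y <- iota 0 n].

Fixpoint element_edges (n l : nat) (C : seq nat) (y : nat) : seq (nat * nat) :=
  if y is y'.+1 then
    [:: (y' + offset n C y', l), (y' + offset n C y' + offset n C y', l.+1)
      & element_edges n l C y']
  else [::].

Definition set_edges (n l : nat) (C : seq nat) : seq (nat * nat) :=
  [:: (3 * n, l), (3 * n + 1, l.+1) & element_edges n l C n].

Fixpoint family_edges (n l : nat) (F : seq (seq nat)) : seq (nat * nat) :=
  if F is C :: F' then set_edges n l C ++ family_edges n l.+2 F' else [::].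

Definition closeness_edges (n : nat) (F : seq (seq nat)) : seq (nat * nat) :=
  clique_edges (3 * n + 2) ++ family_edges n (3 * n + 2) F.

(** With N = 3n + 2 + 2m vertices, 2(N - 1) - (n + 1) = 5n + 4m + 1 is the farness of a set vertex
    that has no vertex at distance 3. *)
Definition farness_bound (n m : nat) : nat := 5 * n + 4 * m + 1 + (2 - m).

Definition flat (s : seq (nat * nat)) : seq nat :=
  flatten [seq [:: e.1; e.2] | e <- s].

Lemma flat_cat s1 s2 : flat (s1 ++ s2) = flat s1 ++ flat s2.
Proof. by rewrite /flat map_cat flatten_cat. Qed.

Lemma size_row_edges b a : size (row_edges b a) = a.
Proof. by elim: a => //= a ->. Qed.

Lemma size_element_edges n l C y : size (element_edges n l C y) = 2 * y.
Proof. by elim: y => //= y ->; lia. Qed.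

Lemma size_family_edges n l F : size (family_edges n l F) = size F * (2 * n + 2).
Proof.
elim: F l => //= C F IH l.
by rewrite size_cat IH size_element_edges; lia.
Qed.

Lemma size_clique_edges b : size (clique_edges b) <= b * b.
Proof. by elim: b => //= b IH; rewrite size_cat size_row_edges; nia. Qed.

(** * Cost of machine runs with bounded register contents *)

Section Machine.
Variables (P : seq instr) (V : nat).

(** [K] bounds the number of instructions. Each is charged for at most two numbers, and these are at
    most [V], hence the price [2 * bitlen V]. *)
Definition bounded_run (s : config) (K : nat) (w : seq nat) : Prop :=
  exists2 t, t <= K * (2 * bitlen V) & halts_in P s t w.

Lemma bounded_run_le K s K' w :
  bounded_run s K w -> K <= K' -> bounded_run s K' w.
Proof.
case=> t tK h KK'; exists t => //; apply: leq_trans tK _.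
by rewrite leq_mul2r KK' orbT.
Qed.

Lemma bounded_run_halt p X u w : size P <= p -> bounded_run (Config p X u w) 0 w.
Proof. by move=> Pp; exists 0 => //; apply: (@halts_now P (Config p X u w)). Qed.

Lemma bounded_run_step p X u w0 ins K w :
  onth P p = Some ins -> cost (Config p X u w0) ins <= 2 * bitlen V ->
  bounded_run (exec (Config p X u w0) ins) K w ->
  bounded_run (Config p X u w0) K.+1 w.
Proof.
move=> Ps cs [t tK h]; exists (cost (Config p X u w0) ins + t).
  by rewrite mulSn leq_add.
exact: halts_step.
Qed.

Lemma bitlen_le a b : a <= b -> bitlen a <= bitlen b.
Proof. by move=> ab; rewrite ltnS leq_trunc_log. Qed.

(* Registers 0 to 14 hold l, and register 15 + y holds mem y. *)
Definition regs (l : seq nat) (mem : nat -> nat) : nat -> nat :=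
  fun r => if r < 15 then nth 0 l r else mem (r - 15).

Lemma set_regs_working l mem i v : i < 15 ->
  set_reg (regs l mem) i v = regs (set_nth 0 l i v) mem.
Proof.
move=> i15; apply/funext => r; rewrite /set_reg /regs nth_set_nth /=.
by case: eqP => [->|//]; rewrite i15.
Qed.

Lemma set_regs_array l mem y v :
  set_reg (regs l mem) (y + 15) v = regs l (set_reg mem y v).
Proof.
apply/funext => r; rewrite /set_reg /regs.
case: ltnP => r15; first by case: eqP => //; lia.
by have -> : (r == y + 15) = (r - 15 == y) by lia.
Qed.

Lemma regs_array l mem y : regs l mem (y + 15) = mem y.
Proof. by rewrite /regs addnK; case: ltnP => //; lia. Qed.

Lemma regsE l mem i : i < 15 -> regs l mem i = nth 0 l i.
Proof. by rewrite /regs => ->. Qed.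

Lemma run_Const i a p l mem u w K w' :
  onth P p = Some (Const i a) -> i < 15 ->
  bounded_run (Config p.+1 (regs (set_nth 0 l i a) mem) u w) K w' ->
  bounded_run (Config p (regs l mem) u w) K.+1 w'.
Proof.
move=> Pp i15 h; apply: (bounded_run_step Pp) => /=; first by rewrite /bitlen; lia.
by rewrite set_regs_working.
Qed.

(** The caller proposes [v] in simplified form, which keeps register contents short along a symbolic
    run. *)
Lemma run_Add v i j k p l mem u w K w' :
  onth P p = Some (Add i j k) -> [&& i < 15, j < 15 & k < 15] ->
  v = nth 0 l j + nth 0 l k -> nth 0 l j <= V -> nth 0 l k <= V ->
  bounded_run (Config p.+1 (regs (set_nth 0 l i v) mem) u w) K w' ->
  bounded_run (Config p (regs l mem) u w) K.+1 w'.
Proof.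
move=> Pp /and3P[i15 j15 k15] -> jV kV h; apply: (bounded_run_step Pp) => /=.
  by rewrite !regsE // mul2n -addnn leq_add // bitlen_le.
by rewrite !regsE // set_regs_working.
Qed.

Lemma run_Sub v i j k p l mem u w K w' :
  onth P p = Some (Defs.Sub i j k) -> [&& i < 15, j < 15 & k < 15] ->
  v = nth 0 l j - nth 0 l k -> nth 0 l j <= V -> nth 0 l k <= V ->
  bounded_run (Config p.+1 (regs (set_nth 0 l i v) mem) u w) K w' ->
  bounded_run (Config p (regs l mem) u w) K.+1 w'.
Proof.
move=> Pp /and3P[i15 j15 k15] -> jV kV h; apply: (bounded_run_step Pp) => /=.
  by rewrite !regsE // mul2n -addnn leq_add // bitlen_le.
by rewrite !regsE // set_regs_working.
Qed.

Lemma run_LoadInd y i j p l mem u w K w' :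
  onth P p = Some (LoadInd i j) -> (i < 15) && (j < 15) ->
  nth 0 l j = y + 15 -> y + 15 <= V -> mem y <= V ->
  bounded_run (Config p.+1 (regs (set_nth 0 l i (mem y)) mem) u w) K w' ->
  bounded_run (Config p (regs l mem) u w) K.+1 w'.
Proof.
move=> Pp /andP[i15 j15] lj yV mV h; apply: (bounded_run_step Pp) => /=.
  by rewrite !(regsE _ _ j15) lj regs_array mul2n -addnn leq_add // bitlen_le.
by rewrite (regsE _ _ j15) lj regs_array set_regs_working.
Qed.

Lemma run_StoreInd y i j p l mem u w K w' :
  onth P p = Some (StoreInd i j) -> (i < 15) && (j < 15) ->
  nth 0 l i = y + 15 -> y + 15 <= V -> nth 0 l j <= V ->
  bounded_run (Config p.+1 (regs l (set_reg mem y (nth 0 l j))) u w) K w' ->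
  bounded_run (Config p (regs l mem) u w) K.+1 w'.
Proof.
move=> Pp /andP[i15 j15] li yV jV h; apply: (bounded_run_step Pp) => /=.
  by rewrite !regsE // li mul2n -addnn leq_add // bitlen_le.
by rewrite !regsE // li set_regs_array.
Qed.

Lemma run_Jump lbl j p l mem u w K w' :
  onth P p = Some (Jump lbl j) -> j < 15 -> 0 < nth 0 l j -> nth 0 l j <= V ->
  bounded_run (Config lbl (regs l mem) u w) K w' ->
  bounded_run (Config p (regs l mem) u w) K.+1 w'.
Proof.
move=> Pp j15 j0 jV h; apply: (bounded_run_step Pp) => /=.
  by rewrite regsE // mul2n -addnn -[bitlen _]addn0 leq_add // bitlen_le.
by rewrite regsE // j0.
Qed.

Lemma run_no_Jump lbl j p l mem u w K w' :
  onth P p = Some (Jump lbl j) -> j < 15 -> nth 0 l j = 0 ->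
  bounded_run (Config p.+1 (regs l mem) u w) K w' ->
  bounded_run (Config p (regs l mem) u w) K.+1 w'.
Proof.
move=> Pp j15 j0 h; apply: (bounded_run_step Pp) => /=.
  by rewrite regsE // j0 mul2n -addnn -[bitlen _]addn0 leq_add // bitlen_le.
by rewrite regsE // j0.
Qed.

Lemma run_Read i p l mem x u w K w' :
  onth P p = Some (Read i) -> i < 15 -> x <= V ->
  bounded_run (Config p.+1 (regs (set_nth 0 l i x) mem) u w) K w' ->
  bounded_run (Config p (regs l mem) (x :: u) w) K.+1 w'.
Proof.
move=> Pp i15 xV h; apply: (bounded_run_step Pp) => /=.
  by rewrite mul2n -addnn -[bitlen _]addn0 leq_add // bitlen_le.
by rewrite set_regs_working.
Qed.

Lemma run_Print i p l mem u w K w' :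
  onth P p = Some (Print i) -> i < 15 -> nth 0 l i <= V ->
  bounded_run (Config p.+1 (regs l mem) u (rcons w (nth 0 l i))) K w' ->
  bounded_run (Config p (regs l mem) u w) K.+1 w'.
Proof.
move=> Pp i15 iV h; apply: (bounded_run_step Pp) => /=.
  by rewrite regsE // mul2n -addnn -[bitlen _]addn0 leq_add // bitlen_le.
by rewrite regsE.
Qed.

End Machine.

(* Registers 0 to 6 hold 1, n, m, 3n + 2, 3n, 3n + 1 and 15, and register 15 + y
   holds n if y is marked and 0 otherwise.  The numbers in comments are the
   addresses of the instructions that follow them. *)
Definition program : seq instr := [::
  Const 0 1; Read 1; Read 2; Const 6 15; Add 4 1 1; Add 4 4 1; Add 5 4 0;
  Add 3 5 0; Add 7 3 2; Add 7 7 2; Print 7;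
  (* 11 *)
  Const 7 0; Add 8 3 7; Jump 16 0; Defs.Sub 8 8 0; Add 7 7 8; Jump 14 8;
  (* 17 *)
  Add 8 2 8; Add 9 1 1; Add 9 9 0; Add 9 9 0; Jump 24 0; Add 7 7 9; Defs.Sub 8 8 0;
  Jump 22 8; Print 7;
  (* 26 *)
  Add 8 3 8; Jump 36 0; Defs.Sub 8 8 0; Const 10 0; Add 9 8 10; Jump 35 0;
  Defs.Sub 9 9 0; Print 9; Print 8; Jump 32 9; Jump 28 8;
  (* 37 *)
  Const 10 0; Add 11 3 10; Add 8 2 10; Jump 70 0;
  Add 12 11 0; Print 4; Print 11; Print 5; Print 12;
  (* 46 *)
  Read 9; Jump 52 0; Read 10; Add 10 10 6; StoreInd 10 1; Defs.Sub 9 9 0; Jump 48 9;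
  (* 53 *)
  Add 9 1 9; Jump 67 0; Defs.Sub 9 9 0; Add 10 9 6; LoadInd 13 10; Defs.Sub 13 1 13;
  Const 14 0; StoreInd 10 14; Add 14 9 13; Print 14; Print 11; Add 14 14 13;
  Print 14; Print 12; Jump 55 9;
  (* 68 *)
  Add 11 12 0; Defs.Sub 8 8 0; Jump 41 8;
  (* 71 *)
  Print 8; Print 0; Const 10 2; Defs.Sub 10 10 2; Add 10 10 5; Add 10 10 1;
  Add 10 10 1; Add 10 10 2; Add 10 10 2; Add 10 10 2; Add 10 10 2; Print 10].

Local Ltac calc := rewrite /=; try lia.
Local Ltac const := eapply run_Const; [reflexivity | done | rewrite /=].
Local Ltac add v := eapply (@run_Add _ _ v);
  [reflexivity | done | calc | calc | calc | rewrite /=].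
Local Ltac sub v := eapply (@run_Sub _ _ v);
  [reflexivity | done | calc | calc | calc | rewrite /=].
Local Ltac jump := eapply run_Jump;
  [reflexivity | done | calc | calc | ].
Local Ltac nojump := eapply run_no_Jump; [reflexivity | done | calc | ].
Local Ltac print := eapply run_Print; [reflexivity | done | calc | rewrite /=].
Local Ltac read := eapply run_Read; [reflexivity | done | calc | rewrite /=].

Local Ltac load y := eapply (@run_LoadInd _ _ y);
  [reflexivity | done | calc | calc | calc | rewrite /=].
Local Ltac store y := eapply (@run_StoreInd _ _ y);
  [reflexivity | done | calc | calc | calc | rewrite /=].

(** * Symbolic execution of the program, loop by loop *)

Section Program.
Variables (V n m : nat).
Hypothesis V_ge : 5 * n + 4 * m + 20 <= V.
Implicit Types (mem : nat -> nat) (u w : seq nat).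

Let run := bounded_run program V.
Local Notation state p a7 a8 a9 a10 a11 a12 a13 a14 :=
  (fun mem u w => Config p (regs [:: 1; n; m; 3 * n + 2; 3 * n; 3 * n + 1; 15;
     a7; a8; a9; a10; a11; a12; a13; a14] mem) u w) (only parsing).

(** The encoding puts the number of edges first, and the machine cannot multiply, so the count is
    summed up beforehand. Like the other loop lemmas, this one starts at the closing test, where the
    counter may be 0, and extends a run from the exit to a run from there. *)
Lemma run_clique_count b acc mem u w K w' :
  acc + b + size (clique_edges b) <= V ->
  run (state 17 (acc + size (clique_edges b)) 0 0 0 0 0 0 0 mem u w) K w' ->
  run (state 16 acc b 0 0 0 0 0 0 mem u w) (3 * b + 1 + K) w'.
Proof.
elim: b acc => [|b IH] acc bV h.
  by apply: bounded_run_le; [nojump; rewrite /= addn0 in h; exact: h | lia].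
rewrite /= size_cat size_row_edges in h bV.
apply: bounded_run_le; [jump; sub b; add (acc + b); apply: IH; first by lia | ].
  by rewrite -addnA; exact: h.
lia.
Qed.

Lemma run_product b d acc mem u w K w' :
  acc + b * d <= V -> b <= V -> d <= V ->
  run (state 25 (acc + b * d) 0 d 0 0 0 0 0 mem u w) K w' ->
  run (state 24 acc b d 0 0 0 0 0 mem u w) (3 * b + 1 + K) w'.
Proof.
elim: b acc => [|b IH] acc abV bV dV h.
  by apply: bounded_run_le; [nojump; rewrite /= addn0 in h; exact: h | lia].
apply: bounded_run_le; [jump; add (acc + d); sub b; apply: IH; try lia | ].
  by rewrite -addnA -mulSn; exact: h.
lia.
Qed.

Lemma run_row b a a7 a10 mem u w K w' :
  a <= V -> b <= V ->
  run (state 36 a7 b 0 a10 0 0 0 0 mem u (w ++ flat (row_edges b a))) K w' ->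
  run (state 35 a7 b a a10 0 0 0 0 mem u w) (4 * a + 1 + K) w'.
Proof.
elim: a w => [|a IH] w aV bV h.
  by apply: bounded_run_le; [nojump; rewrite /= cats0 in h; exact: h | lia].
apply: bounded_run_le; [jump; sub a; print; print; apply: IH; try lia | ].
  by rewrite -!cats1 -!catA; exact: h.
lia.
Qed.

(** Registers 9 and 10 are scratch: their final contents depend on whether the loop is entered, so
    the exit is assumed for all of them. *)
Lemma run_clique b a7 a9 a10 mem u w K w' :
  b <= V ->
  (forall a9 a10,
    run (state 37 a7 0 a9 a10 0 0 0 0 mem u (w ++ flat (clique_edges b))) K w') ->
  run (state 36 a7 b a9 a10 0 0 0 0 mem u w) (4 * (b * b) + 6 * b + 1 + K) w'.
Proof.
elim: b a9 a10 w => [|b IH] a9 a10 w bV h.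
  apply: bounded_run_le; [nojump; rewrite /= cats0 in h; exact: h | lia].
apply: bounded_run_le; [jump; sub b; const; add b; jump | ].
- apply: run_row; try lia.
  apply: IH; first by lia.
  move=> c9 c10; have := h c9 c10.
  by rewrite /= flat_cat catA; exact.
- nia.
Qed.

(** The mark is [n] rather than 1, so that [n] minus a cell is the offset of the element. *)
Lemma run_marks C a7 a8 a10 a11 a12 a13 a14 mem u w K w' :
  all (fun x => x < n) C -> size C <= n ->
  (forall a10 mem', (forall y, mem' y = if y \in C then n else mem y) ->
    run (state 53 a7 a8 0 a10 a11 a12 a13 a14 mem' u w) K w') ->
  run (state 52 a7 a8 (size C) a10 a11 a12 a13 a14 mem (C ++ u) w)
    (5 * size C + 1 + K) w'.
Proof.
elim: C a10 mem => [|x C IH] a10 mem /=.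
  move=> _ _ h; apply: bounded_run_le; [nojump; exact: h | lia].
case/andP=> xn Cn sC h.
apply: bounded_run_le; [jump; read; add (x + 15); store x; sub (size C);
  apply: IH => //; try lia | ].
  move=> b10 mem' memE; apply: h => y; rewrite memE in_cons /set_reg.
  by case: (y == x); case: (y \in C).
lia.
Qed.

(** Each cell is cleared once read. Hence the invariant that only cells below [y] may be marked, and
    an array ready for the next set at the end. *)
Lemma run_elements C y l a7 a8 a10 a13 a14 mem u w K w' :
  y <= n -> l < V ->
  (forall z, mem z = if (z < y) && (z \in C) then n else 0) ->
  (forall a10 a13 a14 mem', (forall z, mem' z = 0) ->
    run (state 68 a7 a8 0 a10 l l.+1 a13 a14 mem' u
           (w ++ flat (element_edges n l C y))) K w') ->
  run (state 67 a7 a8 y a10 l l.+1 a13 a14 mem u w) (13 * y + 1 + K) w'.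
Proof.
elim: y a10 a13 a14 mem w => [|y IH] a10 a13 a14 mem w yn lV memE h.
  apply: bounded_run_le; [nojump | ].
    by have := h a10 a13 a14 mem; rewrite /= cats0; apply.
  lia.
have memy : mem y = n - offset n C y.
  by rewrite memE ltnSn /offset /=; case: (y \in C); rewrite ?subn0 ?subnn.
(* Subtraction is truncated: [n - (n - offset n C y)] gives back the offset because of this
   bound. *)
have offn : offset n C y <= n by rewrite /offset; case: (y \in C).
apply: bounded_run_le; [jump; sub y; add (y + 15); load y; sub (offset n C y);
  const; store y; add (y + offset n C y); print; print;
  add (y + offset n C y + offset n C y); print; print;
  apply: IH => //; try lia | ].
- move=> z; rewrite /set_reg memE.
  case: (z =P y) => [->|zy]; first by rewrite ltnn.
  by have -> : (z < y.+1) = (z < y) by lia.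
- move=> b10 b13 b14 mem' mem'E; rewrite -!cats1 -!catA /=.
  exact: h.
- lia.
Qed.

(** Every turn restores the zero array. A set takes at most [5 * n] instructions for marking,
    [13 * n] for printing its element edges, and 14 others. *)
Lemma run_family F l a7 a9 a10 a12 a13 a14 mem u w K w' :
  all (fun C => all (fun x => x < n) C && (size C <= n)) F ->
  l + 2 * size F < V -> size F <= V ->
  (forall z, mem z = 0) ->
  (forall a9 a10 a11 a12 a13 a14 mem',
    run (state 71 a7 0 a9 a10 a11 a12 a13 a14 mem' u
           (w ++ flat (family_edges n l F))) K w') ->
  run (state 70 a7 (size F) a9 a10 l a12 a13 a14 mem
         (flatten [seq size C :: C | C <- F] ++ u) w)
    (size F * (18 * n + 14) + 1 + K) w'.
Proof.
elim: F l a9 a10 a12 a13 a14 mem w => [|C F IH] l a9 a10 a12 a13 a14 mem w.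
  move=> _ _ _ _ h; apply: bounded_run_le; [nojump | ].
    by have := h a9 a10 l a12 a13 a14 mem; rewrite /= cats0; apply.
  by rewrite /=; lia.
case/andP=> /andP[Cn sC] FF /= lV FV mem0 h.
apply: bounded_run_le; [jump; add l.+1; print; print; print; print; read; jump;
  rewrite -catA; apply: run_marks => // b10 mem' mem'E; add n; jump;
  apply: (@run_elements C) => //; try lia | ].
- move=> z; rewrite mem'E mem0; case: ifP => [zC|]; last by rewrite andbF.
  by rewrite (allP Cn).
- move=> c10 c13 c14 mem2 mem20; add l.+2; sub (size F).
  apply: IH => //; try lia.
  move=> e9 e10 e11 e12 e13 e14 mem3.
  by rewrite -!cats1 -!catA /= -flat_cat; exact: h.
- nia.
Qed.

Lemma run_program F :
  size F = m -> all (fun C => all (fun x => x < n) C && (size C <= n)) F ->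
  size (closeness_edges n F) + 3 * n + 2 <= V ->
  exists2 K, K <= 200 * ((n + 1) * (n + 1) * (m + 1)) &
  run (init [:: n, m & flatten [seq size C :: C | C <- F]]) K
    ([:: 3 * n + 2 + 2 * m, size (closeness_edges n F)
       & flat (closeness_edges n F)] ++ [:: 0; 1; farness_bound n m]).
Proof.
move=> sF FF; rewrite size_cat size_family_edges sF => EV.
have init_regs : (fun=> 0) = regs (nseq 15 0) (fun=> 0).
  by apply/funext => r; rewrite /regs nth_nseq; case: (r < 15).
rewrite /init init_regs.
(* The instruction count is left open, assembled by the rules below, and compared with the bound at
   the end. *)
eexists; last first.
  const; read; read; const; add (2 * n); add (3 * n); add (3 * n + 1).
  add (3 * n + 2); add (3 * n + 2 + m); add (3 * n + 2 + 2 * m); print.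
  const; add (3 * n + 2); jump; apply: run_clique_count; first by lia.
  add m; add (2 * n); add (2 * n + 1); add (2 * n + 2); jump.
  apply: run_product; try lia.
  print; add (3 * n + 2); jump; apply: run_clique; first by lia.
  move=> a9 a10; const; add (3 * n + 2); add m; jump.
  rewrite -[flatten _]cats0; move: (@run_family F (3 * n + 2)); rewrite sF => run_F.
  apply: run_F => //; try lia.
  move=> b9 b10 b11 b12 b13 b14 mem'.
  (* Register 8 has reached 0 and register 0 holds 1: they serve as sign and numerator of the
     threshold. Its denominator starts from the truncated [2 - m]. *)
  print; print; const; sub (2 - m); add (2 - m + (3 * n + 1)).
  add (2 - m + (4 * n + 1)); add (2 - m + (5 * n + 1)).
  add (2 - m + (5 * n + m + 1)); add (2 - m + (5 * n + 2 * m + 1)).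
  add (2 - m + (5 * n + 3 * m + 1)); add (farness_bound n m).
    by rewrite /farness_bound; lia.
  print; first by rewrite /farness_bound; lia.
  rewrite -!cats1 /closeness_edges flat_cat -!catA /=.
  exact: bounded_run_halt.
nia.
Qed.

End Program.

(** * Membership and absence of duplicates in the edge list *)

Lemma nbrsP n (b : bool) (C : seq nat) x :
  reflect [\/ x = 3 * n + b, x < n /\ x \in C |
           exists2 y, (y < n) && (y \notin C) & x = y + b.+1 * n]
    (x \in nbrs n b C).
Proof.
rewrite in_cons; apply: (iffP orP).
  case=> [/eqP->|/mapP[y]]; first by constructor 1.
  rewrite mem_iota /offset /= => yn; case: ifPn => yC ->.
    by constructor 2; rewrite muln0 addn0.
  by constructor 3; exists y => //; rewrite yn.
case=> [->|[xn xC]|[y /andP[yn yC] ->]]; first by left.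
- by right; apply/mapP; exists x; rewrite ?mem_iota // /offset xC muln0 addn0.
- by right; apply/mapP; exists y; rewrite ?mem_iota // /offset (negPf yC).
Qed.

Lemma nbrs_lt n b C x : x \in nbrs n b C -> x < 3 * n + 2.
Proof. by case: b => /nbrsP[->|[xn _]|[y /andP[yn _] ->]]; lia. Qed.

(** Shifted and unshifted elements lie in disjoint intervals of length [n], all below the number
    [3 * n + b]. *)
Lemma uniq_nbrs n b C : uniq (nbrs n b C).
Proof.
rewrite /=; apply/andP; split.
  apply/mapP => -[y]; rewrite mem_iota /offset /=.
  by case: ifP => _; case: b; lia.
rewrite map_inj_in_uniq ?iota_uniq // => y z.
rewrite !mem_iota /offset /=.
by case: ifP; case: ifP; case: b; move=> zC yC; move=> yn zn e;
  try (by lia); move: yC zC; (have -> : y = z by nia).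
Qed.

Lemma size_nbrs n b C : size (nbrs n b C) = n + 1.
Proof. by rewrite /= size_map size_iota addn1. Qed.

Lemma mem_row_edges b a x v : ((x, v) \in row_edges b a) = (v == b) && (x < a).
Proof.
elim: a => [|a IH] /=; first by rewrite ltn0 andbF.
by rewrite in_cons xpair_eqE IH; lia.
Qed.

Lemma mem_clique_edges b x v : ((x, v) \in clique_edges b) = (x < v < b).
Proof.
elim: b => [|b IH] /=; first by rewrite ltn0 andbF.
by rewrite mem_cat mem_row_edges IH; lia.
Qed.

Lemma mem_element_edges n l C y x v :
  ((x, v) \in element_edges n l C y) =
  (l <= v < l.+2) &&
    (x \in [seq z + (odd (v - l)).+1 * offset n C z | z <- iota 0 y]).
Proof.
elim: y => [|y IH]; first by rewrite in_nil andbF.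
rewrite -addn1 iotaD map_cat mem_cat /= addn1 /=.
rewrite !in_cons !xpair_eqE IH in_nil orbF add0n.
case: (v =P l) => [->|vl].
  by rewrite subnn /= mul1n; lia.
case: (v =P l.+1) => [->|vl1]; last by lia.
rewrite subSnn /= mul2n -addnn addnA; lia.
Qed.

Lemma mem_set_edges n l C x v :
  ((x, v) \in set_edges n l C) =
  (l <= v < l.+2) && (x \in nbrs n (odd (v - l)) C).
Proof.
rewrite !in_cons !xpair_eqE mem_element_edges.
case: (v =P l) => [->|vl]; first by rewrite subnn /=; lia.
case: (v =P l.+1) => [->|vl1]; last by lia.
by rewrite subSnn /=; lia.
Qed.

Lemma family_edges_cons n l C F :
  family_edges n l (C :: F) = set_edges n l C ++ family_edges n l.+2 F.
Proof. by []. Qed.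

(** L and R vertices alternate: the parity of [v - l] gives the side, its half the index of the
    set. *)
Lemma mem_family_edges n l F x v :
  ((x, v) \in family_edges n l F) =
  (l <= v < l + 2 * size F) &&
    (x \in nbrs n (odd (v - l)) (nth [::] F (v - l)./2)).
Proof.
elim: F l => [|C F IH] l; first by rewrite in_nil /=; lia.
rewrite family_edges_cons mem_cat mem_set_edges IH /=.
case: (ltnP v l.+2) => vl.
  have -> : (v - l)./2 = 0 by lia.
  by rewrite /=; lia.
have -> : v - l = (v - l.+2).+2 by lia.
by rewrite /= negbK; lia.
Qed.

Lemma mem_closeness_edges n F x v :
  ((x, v) \in closeness_edges n F) =
  (x < v < 3 * n + 2) || (3 * n + 2 <= v < 3 * n + 2 + 2 * size F) &&
    (x \in nbrs n (odd (v - (3 * n + 2))) (nth [::] F (v - (3 * n + 2))./2)).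
Proof. by rewrite mem_cat mem_clique_edges mem_family_edges. Qed.

Lemma uniq_row_edges b a : uniq (row_edges b a).
Proof. by elim: a => //= a ->; rewrite mem_row_edges ltnn andbF. Qed.

Lemma uniq_clique_edges b : uniq (clique_edges b).
Proof.
elim: b => //= b IH; rewrite cat_uniq uniq_row_edges IH andbT /=.
by apply/hasPn => -[x v]; rewrite mem_clique_edges mem_row_edges; lia.
Qed.

(** For [y <= n], core endpoints belonging to different elements differ modulo [n]. *)
Lemma uniq_element_edges n l C y : y <= n -> uniq (element_edges n l C y).
Proof.
elim: y => //= y IH yn; rewrite IH 1?ltnW // andbT in_cons xpair_eqE.
rewrite !mem_element_edges !leqnn subnn subSnn /= negb_or -andbA.
apply/and3P; split; first by rewrite negb_and; lia.
  rewrite andbC; apply/nandP; left; apply/mapP => -[z]; rewrite mem_iota /offset /=.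
  by case: ifP; case: ifP; lia.
rewrite andbC; apply/nandP; left; apply/mapP => -[z]; rewrite mem_iota /offset /=.
by case: ifP; case: ifP; lia.
Qed.

Lemma uniq_set_edges n l C : uniq (set_edges n l C).
Proof.
rewrite /= uniq_element_edges // andbT in_cons xpair_eqE !mem_element_edges.
rewrite !leqnn subnn subSnn /=; apply/andP; split.
  rewrite negb_or; apply/andP; split; first by rewrite negb_and; lia.
  rewrite andbC; apply/nandP; left; apply/mapP => -[z]; rewrite mem_iota /offset /=.
  by case: ifP; lia.
rewrite andbC; apply/nandP; left; apply/mapP => -[z]; rewrite mem_iota /offset /=.
by case: ifP; lia.
Qed.

Lemma uniq_family_edges n l F : uniq (family_edges n l F).
Proof.
elim: F l => // C F IH l; rewrite family_edges_cons cat_uniq.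
rewrite uniq_set_edges IH andbT /=.
by apply/hasPn => -[x v]; rewrite mem_family_edges mem_set_edges; lia.
Qed.

Lemma uniq_closeness_edges n F : uniq (closeness_edges n F).
Proof.
rewrite cat_uniq uniq_clique_edges uniq_family_edges andbT /=.
by apply/hasPn => -[x v]; rewrite mem_family_edges mem_clique_edges; lia.
Qed.

Lemma closeness_edges_oriented n F x v :
  (x, v) \in closeness_edges n F -> x < v < 3 * n + 2 + 2 * size F.
Proof.
rewrite mem_closeness_edges => /orP[|/andP[vF /nbrs_lt]]; lia.
Qed.

(** * Distances and closeness in graphs of diameter at most 3 *)

Section Distance.
Variables (R : realType) (G : mcc_instance).
Implicit Types v w : 'I_(mcc_n G).

Definition far v w : bool :=
  [&& v != w, ~~ adj v w & [forall u, ~~ (adj v u && adj u w)]].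

(** The three terms indicate distance at least 1, 2 and 3, so this is the sum of the distances from
    [v] when none exceeds 3. *)
Definition farness v : nat :=
  \sum_w ((v != w) + ((v != w) && ~~ adj v w) + far v w).

Definition degree v : nat := #|[pred w | adj v w]|.

Definition far_count v : nat := #|[pred w | far v w]|.

Lemma adj_irr v : adj v v = false.
Proof.
have noloop : (v, v) \notin mcc_edges G.
  by apply/negP => /(allP (mcc_oriented G)); rewrite ltnn.
by rewrite /adj (negPf noloop).
Qed.

Lemma adj_sym v w : adj v w = adj w v.
Proof. exact: orbC. Qed.

Lemma far_sym v w : far v w = far w v.
Proof.
rewrite /far eq_sym adj_sym; congr [&& _, _ & _]; apply: eq_forallb => u.
by rewrite andbC (adj_sym u w) (adj_sym v u).
Qed.

(** No walk is shorter than the sum [d] of the indicators, by cases on its length, and some walk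
    attains [d]; for a far pair it is the assumed one. *)
Lemma distE v w :
  (exists p, [/\ path (adj (G := G)) v p, last v p = w & size p <= 3]) ->
  dist R v w =
  (((v != w) + ((v != w) && ~~ adj v w) + far v w)%N%:R%:E)%R.
Proof.
case=> q [vq qw q3]; set d := (_ + _ + _).
have lower p : path (adj (G := G)) v p -> last v p = w -> d <= size p.
  rewrite /d /far; case: p => [|a [|b [|c p]]] /=.
  - by move=> _ ->; rewrite eqxx.
  - by rewrite andbT => va <-; rewrite va /= !andbF; case: (v != a).
  - case/and3P=> va ab _ <-; case: forallP => [/(_ a)|_]; first by rewrite va ab.
    by rewrite !andbF; case: (v != b); case: (adj v b).
  - by move=> _ _; case: (v != w); case: (adj v w); case: [forall _, _].
have upper : exists p, [/\ path (adj (G := G)) v p, last v p = w & size p <= d].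
  have [vw|vw] := eqVneq v w; first by exists [::].
  have [avw|navw] := boolP (adj v w).
    by exists [:: w]; split; rewrite /= ?avw // /d vw.
  have [fvw|] := boolP (far v w); first by exists q; rewrite /d vw navw fvw.
  rewrite /far vw navw /= => /forallPn[u]; rewrite negbK => /andP[vu uw].
  by exists [:: u; w]; split; rewrite /= ?vu ?uw // /d vw navw /=.
apply/eqP; rewrite eq_le; apply/andP; split; last first.
  apply: le_ereal_inf_tmp => _ [p [vp pw] <-].
  by rewrite lee_fin ler_nat lower.
case: upper => p [vp pw pd]; apply: ge_ereal_inf.
by exists ((size p)%:R%:E)%R; [exists p | rewrite lee_fin ler_nat].
Qed.

(** Holds term by term: since [v] is not adjacent to itself, the indicators of adjacency and of
    being distinct and nonadjacent add up to that of [v != w]. *)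
Lemma farness_degree v :
  farness v + degree v = 2 * (mcc_n G).-1 + far_count v.
Proof.
have card_neq : \sum_w (v != w : nat) = (mcc_n G).-1.
  rewrite -[in RHS](card_ord (mcc_n G)) (cardD1 v) inE /=.
  rewrite -sum1_card [RHS]big_mkcond /=.
  by apply: eq_bigr => w _; rewrite !inE andbT eq_sym; case: (_ == _).
rewrite /degree /far_count -!sum1_card !(big_mkcond (fun w => w \in _)) /=.
rewrite mul2n -addnn.
rewrite -[in RHS]card_neq /farness -!big_split; apply: eq_bigr => w _ /=.
rewrite !inE; have [<-|_] := eqVneq v w; first by rewrite adj_irr /far eqxx.
by case: (adj v w); case: (far v w).
Qed.

(** Keeps the closeness away from the default [0^-1 = +oo]. *)
Lemma farness_gt0 v : 1 < mcc_n G -> 0 < farness v.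
Proof.
move=> n1; have := farness_degree v.
have : degree v <= (mcc_n G).-1.
  rewrite -ltnS (ltn_predK n1) -[X in _ < X]card_ord /degree.
  apply: proper_card; apply/properP; split; first by apply/fintype.subsetP => w.
  by exists v; rewrite // inE adj_irr.
lia.
Qed.

Lemma closeness_lt_inv T :
  (forall v w, exists p,
    [/\ path (adj (G := G)) v p, last v p = w & size p <= 3]) ->
  1 < mcc_n G -> 0 < T -> mcc_threshold G = (T%:R^-1)%R ->
  mcc_answer R G <-> exists v, T < farness v.
Proof.
move=> diam3 n1 T0 thr.
have closE v : closeness R v = ((farness v)%:R^-1%:E)%R.
  rewrite /closeness (eq_bigr _ (fun w _ => distE (diam3 v w))) sumEFin -natr_sum.
  rewrite -/(farness v) inver pnatr_eq0 gtn_eqF ?farness_gt0 //.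
  by rewrite mul1e.
rewrite /mcc_answer; split=> -[v h]; exists v; move: h; rewrite closE thr;
  by rewrite [ratr _]fmorphV rmorph_nat lte_fin
    ltf_pV2 ?posrE ?ltr0n ?farness_gt0 // ltr_nat.
Qed.

End Distance.

(** * The graph of a family of sets and its pairs at distance 3 *)

Section ClosenessGraph.
Variables (n : nat) (F : seq (seq nat)).

(** A syntactic successor, as the type of [inord] demands. *)
Definition graph_order : nat := (3 * n + 2 * size F).+2.

Lemma graph_orderE : graph_order = 3 * n + 2 + 2 * size F.
Proof. by rewrite /graph_order; lia. Qed.

Definition graph_edges : seq ('I_graph_order * 'I_graph_order) :=
  [seq (inord e.1, inord e.2) | e <- closeness_edges n F].

Lemma val_edge e : e \in closeness_edges n F ->
  (inord e.1 : 'I_graph_order) = e.1 :> nat /\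
  (inord e.2 : 'I_graph_order) = e.2 :> nat.
Proof.
case: e => x v /closeness_edges_oriented /andP[xv]; rewrite -graph_orderE => vN.
by rewrite !inordK //; apply: ltn_trans vN.
Qed.

Lemma uniq_graph_edges : uniq graph_edges.
Proof.
rewrite map_inj_in_uniq ?uniq_closeness_edges // => -[x v] [y w] xv yw /= [].
have [/= <- <-] := val_edge xv; have [/= <- <-] := val_edge yw.
by rewrite !inord_val => -> ->.
Qed.

Lemma graph_edges_oriented :
  all (fun e : 'I_graph_order * 'I_graph_order => e.1 < e.2) graph_edges.
Proof.
apply/allP => _ /mapP[[x v] xv ->] /=; have [/= -> ->] := val_edge xv.
by case/andP: (closeness_edges_oriented xv).
Qed.

Definition closeness_graph : mcc_instance :=
  MCCInstance uniq_graph_edges graph_edges_oriented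
    (((farness_bound n (size F))%:R)^-1)%R.

Lemma mem_graph_edges (x v : 'I_graph_order) :
  ((x, v) \in graph_edges) = ((x : nat, v : nat) \in closeness_edges n F).
Proof.
apply/mapP/idP => [[[y w] yw [-> ->]]|xv].
  by have [/= -> ->] := val_edge yw.
by exists (x : nat, v : nat) => //=; rewrite !inord_val.
Qed.

Lemma encode_closeness_graph :
  mcc_encode closeness_graph =
  [:: 3 * n + 2 + 2 * size F, size (closeness_edges n F)
    & flat (closeness_edges n F)] ++ [:: 0; 1; farness_bound n (size F)].
Proof.
rewrite /mcc_encode /= -graph_orderE size_map -map_comp; congr [:: _, _ & _ ++ _].
  rewrite /flat; congr flatten; apply/eq_in_map => e /val_edge[/= e1 e2].
  by rewrite e1 e2.
have b0 : 0 < farness_bound n (size F) by rewrite /farness_bound; lia.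
(* The fraction with numerator 1 is in lowest terms, so [numq] and [denq] can be read off. *)
have cop : coprime `|1|%N `|farness_bound n (size F)|%N by rewrite coprime1n.
rewrite -[(_^-1)%R]mul1r -[(1 / _)%R]/(1%:~R / (farness_bound n (size F))%:~R)%R.
rewrite ltNge divr_ge0 ?ler0n //= coprimeq_num // coprimeq_den //.
by rewrite mulr1 gtr0_sg //; case: (farness_bound n (size F)) b0.
Qed.

Local Notation k := (3 * n + 2).
Local Notation G := closeness_graph.
Local Notation V := 'I_graph_order.

(** Meaningful from [k] on, where true means an R vertex; the truncated difference is 0 on the
    core. *)
Definition side (v : V) : bool := odd (v - k).
Definition vertex_list (v : V) : seq nat := nth [::] F (v - k)./2.
Definition vnbrs (v : V) : seq nat := nbrs n (side v) (vertex_list v).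

Lemma adj_core (v w : V) : v < k -> w < k -> @adj G v w = (v != w).
Proof.
move=> vk wk; rewrite /adj /= !mem_graph_edges !mem_closeness_edges -val_eqE /=.
lia.
Qed.

(** All of [nbrs] lies in the core, so two set vertices are never adjacent and the list of [w]
    decides. *)
Lemma adj_set (v w : V) : k <= w -> @adj G v w = ((v : nat) \in vnbrs w).
Proof.
move=> kw; rewrite /adj /= !mem_graph_edges !mem_closeness_edges.
have := ltn_ord w; rewrite {2}graph_orderE => wN; rewrite kw wN.
rewrite [w < k]ltnNge kw andbF /= -/(side w) -/(vertex_list w) -/(vnbrs w).
case: (boolP (_ \in vnbrs w)) => // _ /=.
apply/negbTE; rewrite negb_or; apply/andP; split; first by lia.
by apply/negP => /andP[kv /nbrs_lt]; rewrite ltnNge kw.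
Qed.

Lemma hub_lt (v : V) : 3 * n + side v < graph_order.
Proof. by rewrite graph_orderE; case: side; lia. Qed.

(** This is z for L_i and z' for R_i. *)
Definition hub (v : V) : V := Ordinal (hub_lt v).

Lemma hub_core (v : V) : hub v < k.
Proof. by rewrite /=; case: side; lia. Qed.

Lemma adj_hub (v : V) : k <= v -> @adj G (hub v) v.
Proof. by move=> kv; rewrite adj_set // in_cons eqxx. Qed.

(** At most one step into the core, one across the clique, and one out of the core. *)
Lemma diameter_le3 (v w : V) :
  exists p, [/\ path (adj (G := G)) v p, last v p = w & size p <= 3].
Proof.
have [p [vp p1 pk]] : exists p : seq V,
    [/\ path (adj (G := G)) v p, size p <= 1 & last v p < k].
  case: (ltnP v k) => vk; first by exists [::].
  exists [:: hub v]; split=> //=; first by rewrite adj_sym adj_hub.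
  exact: hub_core.
have [h [hk [q [hq qw q1]]]] : exists h : V, h < k /\ exists q : seq V,
    [/\ path (adj (G := G)) h q, last h q = w & size q <= 1].
  case: (ltnP w k) => wk; first by exists w; split=> //; exists [::].
  exists (hub w); split; first exact: hub_core.
  by exists [:: w]; split=> //=; rewrite adj_hub.
have [eh|neh] := eqVneq (last v p) h.
  exists (p ++ q); rewrite cat_path vp last_cat eh hq size_cat; split=> //.
  exact: leq_trans (leq_add p1 q1) _.
exists (p ++ h :: q); rewrite cat_path vp last_cat /= adj_core // neh hq.
by rewrite size_cat /= addnS; split=> //; apply: (leq_add p1 q1).
Qed.

Lemma degree_set (v : V) : k <= v -> @degree G v = n + 1.
Proof.
move=> kv; rewrite -(size_nbrs n (side v) (vertex_list v)).
have sub : {subset vnbrs v <= iota 0 graph_order}.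
  by move=> x /nbrs_lt; rewrite mem_iota graph_orderE; lia.
have -> : size (nbrs n (side v) (vertex_list v)) =
    size [seq inord x : V | x <- vnbrs v].
  by rewrite size_map.
rewrite -(card_uniqP _).
  apply: eq_card => w; rewrite inE adj_sym adj_set //.
  apply/idP/mapP => [wv|[x xv ->]]; first by exists (w : nat); rewrite ?inord_val.
  by rewrite inordK //; have := sub x xv; rewrite mem_iota.
rewrite map_inj_in_uniq ?uniq_nbrs // => x y /sub + /sub.
rewrite !mem_iota /= => xN yN /(congr1 val); rewrite /= !inordK //.
Qed.

(** The clique alone gives this degree; with nobody at distance 3, the farness is then at most 3n +
    4m + 1, within the bound. *)
Lemma degree_core (v : V) : v < k -> 3 * n + 1 <= @degree G v.
Proof.
move=> vk; have kN : k <= graph_order by rewrite graph_orderE; lia.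
have card_core : #|[pred w : V | w < k]| = k.
  by rewrite -sum1_card -(big_ord_widen _ (fun=> 1) kN) sum1_card card_ord.
have le_deg : #|[predD1 [pred w : V | w < k] & v]| <= @degree G v.
  apply: subset_leq_card; apply/fintype.subsetP => w.
  by rewrite !inE => /andP[wv wk]; rewrite adj_core // eq_sym.
apply: leq_trans le_deg; move: card_core.
by rewrite (cardD1 v) inE vk add1n [k]addn2 addn1 => -[->].
Qed.

(** The hub of a set vertex [w] is either [v] or a common neighbour. *)
Lemma far_core (v w : V) : v < k -> ~~ @far G v w.
Proof.
move=> vk; rewrite /far; case: (ltnP w k) => wk.
  by rewrite adj_core //; case: eqP.
case: (v =P w) => //= _; rewrite negb_and negbK.
have [->|nv] := eqVneq v (hub w); first by rewrite adj_hub.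
apply/orP; right; apply/forallPn; exists (hub w).
by rewrite negbK adj_hub // adj_core ?nv ?hub_core.
Qed.

(** Vertices on the same side share their hub. On opposite sides only an element of both sets is a
    common neighbour. List entries from [n] on leave no trace in the graph, hence the filter. *)
Lemma far_setP (v w : V) :
  @far G v w <-> [/\ k <= v, k <= w, side v != side w &
                  ~~ has (mem (vertex_list w)) [seq x <- vertex_list v | x < n]].
Proof.
split.
  move=> fvw; have kv : k <= v.
    by rewrite leqNgt; apply: contraL fvw => /far_core; apply.
  have kw : k <= w.
    by rewrite leqNgt; apply: contraL fvw; rewrite far_sym => /far_core; apply.
  case/and3P: fvw => vw _ /forallP common.
  have nocommon x : x \in vnbrs v -> x \notin vnbrs w.
    move=> xv; have xN : x < graph_order.
      by rewrite graph_orderE; have := nbrs_lt xv; lia.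
    by have := common (Ordinal xN); rewrite adj_sym !adj_set //= xv.
  split=> //.
    apply/eqP => e; have := nocommon (3 * n + side v).
    by rewrite in_cons eqxx e in_cons eqxx /= => /(_ isT).
  apply/hasPn => x; rewrite mem_filter => /andP[xn xv] /=.
  apply/negP => xw; have xv' : x \in vnbrs v by apply/nbrsP; constructor 2.
  by move: (nocommon x xv'); apply/negP; rewrite negbK; apply/nbrsP; constructor 2.
case=> kv kw svw /hasPn disj; apply/and3P; split.
- by apply: contraNneq svw => ->.
- by rewrite adj_set //; apply/negP => /nbrs_lt; rewrite ltnNge kv.
- apply/forallP => u; rewrite adj_sym !adj_set //; apply/negP => /andP[].
  (* Of the nine combinations, disjointness excludes the one where [u] is an element of both lists;
     numbering and opposite sides exclude the others. *)
  case/nbrsP=> [eu|[un uv]|[y /andP[yn yv] eu]];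
    case/nbrsP=> [eu'|[un' uw]|[y' /andP[yn' yw] eu']]; move: svw.
  + by case: (side v) eu; case: (side w) eu'; rewrite /=; lia.
  + by case: (side v) eu; case: (side w); rewrite /=; lia.
  + by case: (side v) eu; case: (side w) eu'; rewrite /=; lia.
  + by case: (side v); case: (side w) eu'; rewrite /=; lia.
  + by move=> _; move: (disj u); rewrite mem_filter un uv /= uw => /(_ isT).
  + by case: (side v); case: (side w) eu'; rewrite /=; lia.
  + by case: (side v) eu; case: (side w) eu'; rewrite /=; lia.
  + by case: (side v) eu; case: (side w); rewrite /=; lia.
  + by case: (side v) eu; case: (side w) eu'; rewrite /=; lia.
Qed.

(** A set vertex exceeds the bound exactly when more than [2 - size F] vertices are far from it; a
    core vertex never does. *)
Lemma farness_gtP :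
  (exists v : V, farness_bound n (size F) < @farness G v) <->
  1 < size F /\ exists v w : V, @far G v w.
Proof.
have farE (v : V) :
    @farness G v + @degree G v = 2 * (3 * n + 2 * size F).+1 + @far_count G v.
  exact: (@farness_degree G).
split=> [[v]|[F2 [v [w fvw]]]]; last first.
  have [kv _ _ _] := (far_setP v w).1 fvw.
  have : 0 < @far_count G v by apply/card_gt0P; exists w.
  exists v; move: (farE v); rewrite degree_set // /farness_bound; lia.
case: (ltnP v k) => vk.
  have far0 : @far_count G v = 0.
    by apply: eq_card0 => w; rewrite inE; apply/negbTE/far_core.
  by move: (farE v) (degree_core vk); rewrite far0 /farness_bound; lia.
move: (farE v); rewrite degree_set // /farness_bound => fE fv.
have fc : 2 - size F < @far_count G v by lia.
have vN := ltn_ord v; rewrite [X in _ < X]graph_orderE in vN.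
split; last first.
  have /card_gt0P[w fvw] : 0 < @far_count G v by lia.
  by exists v, w.
(* With at most one set, at least two far vertices would be required, but at most one vertex lies on
   the side opposite to [v]. *)
rewrite ltnNge; apply/negP => F1.
have far_uniq (w w' : V) : @far G v w -> @far G v w' -> w = w'.
  move=> /far_setP[_ kw sw _] /far_setP[_ kw' sw' _].
  have wN := ltn_ord w; rewrite [X in _ < X]graph_orderE in wN.
  have wN' := ltn_ord w'; rewrite [X in _ < X]graph_orderE in wN'.
  by apply: val_inj; move: sw sw'; rewrite /side /=; lia.
have /card_gt1P[w [w' [fw fw' /eqP]]] : 1 < @far_count G v by lia.
by apply; apply: far_uniq.
Qed.

End ClosenessGraph.

(** * Equivalence of the answers *)

Section Reduction.
Variables (R : realType) (c : R).
Implicit Types I : bigTDS_instance c.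

Definition tds_lists I : seq (seq nat) :=
  [seq [seq val x | x <- C] | C : seq 'I_(tds_n I) <- tds_sets I].

Definition closeness_reduction I : mcc_instance :=
  closeness_graph (tds_n I) (tds_lists I).

Lemma size_tds_lists I : size (tds_lists I) = size (tds_sets I).
Proof. exact: size_map. Qed.

Lemma tds_lists_lt I :
  all (fun C => all (fun x => x < tds_n I) C && (size C <= tds_n I)) (tds_lists I).
Proof.
apply/allP => _ /mapP[C CI ->]; apply/andP; split.
  by apply/allP => _ /mapP[x _ ->]; exact: ltn_ord.
rewrite size_map -[X in _ <= X](card_ord (tds_n I)) cardE.
by apply: uniq_leq_size => [|x _]; rewrite ?mem_enum // (allP (tds_uniq_elements I)).
Qed.

Lemma nth_tds_lists I i (x : 'I_(tds_n I)) : i < size (tds_sets I) ->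
  ((x : nat) \in nth [::] (tds_lists I) i) = (x \in nth set0 (tds_collection I) i).
Proof.
move=> im; rewrite /tds_lists /tds_collection !(nth_map [::]) // inE.
exact: (mem_map val_inj).
Qed.

Lemma disjoint_nthP I i j : i < size (tds_sets I) -> j < size (tds_sets I) ->
  ~~ has (mem (nth [::] (tds_lists I) j))
       [seq x <- nth [::] (tds_lists I) i | x < tds_n I] <->
  [disjoint nth set0 (tds_collection I) i & nth set0 (tds_collection I) j].
Proof.
move=> im jm; split.
  move/hasPn => disj; apply/pred0P => x /=; apply/negbTE/negP => /andP[xi xj].
  have := disj x; rewrite mem_filter ltn_ord /= nth_tds_lists // xi => /(_ isT).
  by rewrite /= nth_tds_lists // xj.
move/pred0P => disj; apply/hasPn => x; rewrite mem_filter => /andP[xn xi] /=.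
have := disj (Ordinal xn); rewrite /= -!nth_tds_lists //= xi /= => ->.
by [].
Qed.

Lemma closeness_reduction_answer I :
  tds_answer I <-> mcc_answer R (closeness_reduction I).
Proof.
set m := size (tds_sets I); set n := tds_n I.
have sm : size (tds_lists I) = m := size_tds_lists I.
have sc : size (tds_collection I) = m by rewrite size_map.
have coll_mem i : i < m -> nth set0 (tds_collection I) i \in tds_collection I.
  by move=> im; rewrite mem_nth // sc.
rewrite (@closeness_lt_inv R _ (farness_bound n m)) //; first last.
- by rewrite /= sm.
- by rewrite /farness_bound; lia.
- exact: diameter_le3.
rewrite /closeness_reduction -sm; rewrite farness_gtP sm; split.
  case=> _ [_ [/(nthP set0)[i im <-] /(nthP set0)[j jm <-] /eqP ij disj]].
  rewrite sc in im jm; have {}ij : i != j by apply: contraNneq ij => ->.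
  split; first by lia.
  (* The far pair consists of L_i and R_j. *)
  have vN : 3 * n + 2 + 2 * i < graph_order n (tds_lists I).
    by rewrite graph_orderE sm; lia.
  have wN : 3 * n + 2 + (2 * j).+1 < graph_order n (tds_lists I).
    by rewrite graph_orderE sm; lia.
  exists (Ordinal vN), (Ordinal wN); apply/far_setP.
  split; rewrite /side /vertex_list /= ?leq_addr ?addKn //.
    by rewrite /= !mul2n !odd_double.
  have -> : (2 * i)./2 = i by lia.
  have -> : (2 * j).+1./2 = j by lia.
  exact/disjoint_nthP.
case=> m2 [v [w /far_setP[kv kw _]]].
have vN := ltn_ord v; rewrite [X in _ < X]graph_orderE sm in vN.
have wN := ltn_ord w; rewrite [X in _ < X]graph_orderE sm in wN.
have im : (v - (3 * n + 2))./2 < m by lia.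
have jm : (w - (3 * n + 2))./2 < m by lia.
move/(disjoint_nthP im jm) => disj.
set A := nth set0 _ _ in disj; set B := nth set0 _ _ in disj.
have [AB|AB] := eqVneq A B; last first.
  by exists A, B; split; [exact: coll_mem | exact: coll_mem | exact/eqP | ].
(* A set disjoint from itself is empty, hence disjoint from every other member; as [m] is at least 2
   there is one, and it differs from [A] because the collection has no repetition. *)
have A0 : A = set0 by move: disj; rewrite -AB -setI_eq0 setIid => /eqP.
have [k km kA] : exists2 k, k < m & k != (v - (3 * n + 2))./2.
  by case: ((v - (3 * n + 2))./2) => [|i]; [exists 1 | exists 0]; lia.
exists A, (nth set0 (tds_collection I) k); split.
- exact: coll_mem.
- exact: coll_mem.
- apply/eqP; rewrite eq_sym nth_uniq ?sc //; exact: tds_uniq_sets.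
- by rewrite A0 -setI_eq0 set0I.
Qed.

(** * Quasilinear running time *)

Lemma log2_nat_bounds (m : nat) : 1 < m ->
  (1 <= log2 (m%:R : R) <= (trunc_log 2 m).+1%:R)%R.
Proof.
move=> m1; have ln2 : (0 < ln 2 :> R)%R by rewrite ln_gt0 // ltr1n.
have m0 : (0 < m%:R :> R)%R by rewrite ltr0n; lia.
rewrite /log2 ler_pdivlMr // mul1r ler_pdivrMr //; apply/andP; split.
  by rewrite ler_ln ?posrE // ler_nat.
rewrite mulr_natl -lnXn // ler_ln ?posrE ?exprn_gt0 //.
by rewrite -natrX ler_nat ltnW // trunc_log_ltn.
Qed.

(** A base at least 1 allows [c] to be replaced by a natural number above its absolute value, which
    depends on [c] alone. *)
Lemma tds_n_polylog : exists q, forall I,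
  tds_n I + 1 <= (trunc_log 2 (size (tds_sets I))).+1 ^ q.
Proof.
exists (Num.bound `|c|%R) => I; have := tds_big I.
set m := size (tds_sets I); set n := tds_n I; rewrite addn1 => nm.
(* For at most one set the logarithm is 0 ([ln 0] being 0 by convention), and a power of 0 is at
   most 1, so [n] is 0. *)
have [m1|m1] := ltnP 1 m; last first.
  have m0 : (log2 (m%:R : R) = 0)%R.
    rewrite /log2; case: m m1 {nm} => [|[|//]] _; first by rewrite ln0 ?mul0r.
    by rewrite ln1 mul0r.
  move: nm; rewrite m0 => nm; have : (n%:R < 1 :> R)%R.
    apply: lt_le_trans nm _; have [->|c0] := eqVneq c 0%R; first by rewrite powRr0.
    by rewrite powR0.
  by rewrite ltrn1 => n1; apply: leq_trans n1 _; rewrite expn_gt0.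
have /andP[l1 lL] := log2_nat_bounds m1.
rewrite -(ltr_nat R); apply: lt_le_trans nm _.
apply: (@le_trans _ _ (log2 (m%:R : R) `^ (Num.bound `|c|%R)%:R)%R).
  by apply: ler_powR => //; apply/ltW/(le_lt_trans (ler_norm c))/archi_boundP.
rewrite powR_mulrn ?(le_trans ler01) // natrX lerXn2r //.
  by rewrite nnegrE (le_trans ler01).
by rewrite nnegrE.
Qed.

Lemma size_le_inst_size (P : problem) (J : P) : size (encode J) <= inst_size J.
Proof. by rewrite /inst_size -sum1_size leq_sum. Qed.

(** Each set contributes at least its length field, and the header has two entries. *)
Lemma sets_lt_inst_size I :
  (size (tds_sets I)).+1 <= @inst_size (BigTwoDisjointSets c) I.
Proof.
apply: leq_trans (@size_le_inst_size (BigTwoDisjointSets c) I).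
rewrite /= ltnS; elim: (tds_sets I) => //= C s IH.
by rewrite size_cat size_map; lia.
Qed.

Lemma leq_expl e m n : m <= n -> m ^ e <= n ^ e.
Proof. by move=> mn; elim: e => // e IH; rewrite !expnS leq_mul. Qed.

(** Only logarithms matter, so [B <= 2 ^ B] is good enough: with 100 < 2^7 the product is below 2^(7
    + 2qB + B). *)
Lemma bitlen_polylog (B n m q : nat) :
  0 < B -> m + 1 <= 2 ^ B -> n + 1 <= B ^ q ->
  bitlen (100 * ((n + 1) * (n + 1) * (m + 1))) <= (8 + 2 * q) * B.
Proof.
move=> B0 m2 nB.
have BB : B <= 2 ^ B by apply/ltnW/ltn_expl.
have n2 : n + 1 <= 2 ^ (B * q).
  by rewrite expnM; apply: leq_trans nB _; apply: leq_expl.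
have lt : 100 * ((n + 1) * (n + 1) * (m + 1)) < 2 ^ (7 + (B * q + B * q + B)).
  rewrite !expnD.
  apply: (@leq_ltn_trans (100 * (2 ^ (B * q) * 2 ^ (B * q) * 2 ^ B))).
    by rewrite leq_mul2l !leq_mul.
  by rewrite ltn_pmul2r // !muln_gt0 !expn_gt0.
have pos : 0 < 100 * ((n + 1) * (n + 1) * (m + 1)) by lia.
have := leq_ltn_trans (trunc_logP (isT : 1 < 2) pos) lt.
by rewrite ltn_exp2l // /bitlen; nia.
Qed.

(** From s = 2 on, 1 + log s is at most 2 log s, whence the factor [2 ^ j]. *)
Lemma quasilinear_polylog C j :
  quasilinear (fun s => C * (s * (trunc_log 2 s).+1 ^ j)).
Proof.
exists j, (C * 2 ^ j), 2 => s s2; rewrite -mulnA leq_mul2l; apply/orP; right.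
rewrite mulnCA leq_mul2l -expnMn; apply/orP; right.
have : 0 < trunc_log 2 s by rewrite trunc_log_gt0.
by move=> L0; apply: leq_expl; lia.
Qed.

(** With B = 1 + log s there are at most 200 B^(2q) s instructions, each of cost at most 2(8 +
    2q)B. *)
Lemma closeness_reduction_ql :
  @ql_computable (BigTwoDisjointSets c) (MinimumClosenessCentrality R)
    closeness_reduction.
Proof.
have [q nq] := tds_n_polylog.
exists program,
  (fun s => 400 * (8 + 2 * q) * (s * (trunc_log 2 s).+1 ^ (2 * q + 1))).
split; first exact: quasilinear_polylog.
move=> I; set s := inst_size _; set n := tds_n I; set m := size (tds_sets I).
set B := (trunc_log 2 s).+1.
have ms : m < s := sets_lt_inst_size I.
have nB : n + 1 <= B ^ q.
  apply: leq_trans (nq I) _; apply: leq_expl; rewrite ltnS leq_trunc_log //.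
  exact: ltnW.
(* [W] dominates the values handled by the program, including the number of edges. *)
pose W := 100 * ((n + 1) * (n + 1) * (m + 1)).
have [||K KB] := @run_program W n m _ (tds_lists I)
  (size_tds_lists I) (tds_lists_lt I).
- by rewrite /W; nia.
- rewrite size_cat size_family_edges size_tds_lists -/m /W.
  by have := size_clique_edges (3 * n + 2); nia.
case=> t tK halts; exists t; last first.
  have -> : encode I = [:: n, m & flatten [seq size C :: C | C <- tds_lists I]].
    rewrite /= /tds_encode /tds_lists -map_comp; congr [:: _, _ & flatten _].
    by apply: eq_map => C /=; rewrite size_map.
  by rewrite /= /closeness_reduction encode_closeness_graph size_tds_lists.
apply: leq_trans tK _.
have bW : bitlen W <= (8 + 2 * q) * B.
  apply: bitlen_polylog nB => //; rewrite addn1; apply: leq_trans ms _.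
  exact/ltnW/trunc_log_ltn.
have KS : K <= 200 * (B ^ q * B ^ q * s).
  by apply: leq_trans KB _; rewrite leq_mul2l !leq_mul // addn1.
apply: (@leq_trans (200 * (B ^ q * B ^ q * s) * (2 * ((8 + 2 * q) * B)))).
  by rewrite leq_mul // leq_mul2l.
rewrite -/B; have -> : B ^ (2 * q + 1) = B ^ q * B ^ q * B.
  by rewrite expnD expn1 mul2n -addnn expnD.
by move: (B ^ q) => X; nia.
Qed.

End Reduction.

Theorem theorem6 (R : realType) (c : R) :
  BigTwoDisjointSets c <=ql MinimumClosenessCentrality R.
Proof.
exists (@closeness_reduction R c); first exact: closeness_reduction_ql.
exact: closeness_reduction_answer.
Qed.
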